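(* Let $\mathcal{A}=(a_i)_{i=1}^\infty$ be a weakly increasing sequence of positive integers, $k$ a positive integer, and $\alpha$ a positive real number. The sequence $\left(p_\mathcal{A}(n,k)/n^\alpha\right)_{n\ge1}$ is eventually log-concave, i.e. there is $N$ such that $$\left(\frac{p_\mathcal{A}(n,k)}{n^\alpha}\right)^2>\frac{p_\mathcal{A}(n+1,k)}{(n+1)^\alpha}\cdot\frac{p_\mathcal{A}(n-1,k)}{(n-1)^\alpha}\quad\text{for all } n\geq N,$$ if and only if $k>\alpha+1$ and either $2\leq k\leq 3$ and $a_1=\cdots=a_k=1$, or $k\geq 4$ and $\gcd A=1$ for all $(k-2)$-multisubsets $A$ of $\{a_1,\ldots,a_k\}$.
   Context: For a weakly increasing sequence $\mathcal{A}=(a_i)_{i\ge1}$ of positive integers and a positive integer $k$, the restricted partition function $p_\mathcal{A}(n,k)$ is defined by $\sum_{n\ge0}p_\mathcal{A}(n,k)x^n=\prod_{i=1}^k(1-x^{a_i})^{-1}$; equivalently, it counts the partitions of $n$ whose parts lie in the multiset $\{a_1,\ldots,a_k\}$ (equal values with different indices count as distinct colors). A $j$-multisubset of $\{a_1,\ldots,a_k\}$ is a sub-multiset obtained by choosing $j$ of the $k$ indices. *)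

(* Defs.v *)
From HB Require Import structures.
From mathcomp Require Import all_boot all_order all_algebra.
From mathcomp Require Import all_classical all_reals all_analysis.
Set Implicit Arguments. Unset Strict Implicit. Unset Printing Implicit Defensive.

(* The sequence A = (a_1, a_2, ...) is represented 0-indexed: a_{i+1} = a i. *)

(* p_A(n,k): number of k-tuples (c_1..c_k) of nonnegative integers with
   sum_i c_i a_i = n, i.e. the coefficient of x^n in prod_{i<=k} (1-x^{a_i})^{-1}.
   Since every a_i >= 1, each c_i <= n, so ranging c_i over 'I_n.+1 is exhaustive. *)
Definition pA (a : nat -> nat) (n k : nat) : nat :=
  #|[set c : {ffun 'I_k -> 'I_n.+1} | (\sum_(i < k) c i * a i)%N == n]|.

Definition gcd_sub (a : nat -> nat) (k : nat) (S : {set 'I_k}) : nat :=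
  \big[gcdn/0%N]_(i in S) a i.

(* Main.v *)
Require Import Defs.
From HB Require Import structures.
From mathcomp Require Import all_boot all_order all_algebra.
From mathcomp Require Import all_classical all_reals all_analysis.
From mathcomp Require Import cyclotomic zify ring lra.
Set Implicit Arguments. Unset Strict Implicit. Unset Printing Implicit Defensive.
Import Order.TTheory GRing.Theory Num.Theory.
Import numFieldNormedType.Exports.
Local Open Scope ring_scope.

(** Write K = k - 1, p(n) = p_A(n,k) and c = 1 / (K! a_1 ... a_k).  Factoring
    1 - X^a into cyclotomic polynomials shows that if every d > 1 divides at most
    e of the a_i, then the (K - e)-th difference of p is asymptotic to
    n^e / (e! a_1 ... a_k).  The gcd condition is the case e = K - 2, and the
    resulting asymptotics of p, Dp and D^2p give p(n)^2 - p(n+1) p(n-1) ~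
    K c^2 n^(2K-2), which beats the factor (1 - 1/n^2)^alpha iff alpha < K.

    Conversely, log-concavity makes p itself strictly log-concave, hence strictly
    increasing (a decreasing log-concave sequence of naturals cannot last).
    - If d > 1 divided all the a_i but b, then p(n) - p(n-b), which counts
      partitions into multiples of d, would vanish for some large n.  So p and Dp
      have the expected asymptotics.
    - If alpha >= K, then p(n) / n^K is log-concave with consecutive ratios tending
      to 1, so it increases to c and p(n) <= c n^K.  Summing contradicts
      p(0) + ... + p(n) >= c (n+1)^k / k.
    - Log-concavity bounds D^2p(n) from above by about c (K^2 - alpha) n^(K-2),
      which is less than twice its mean c K (K - 1) n^(K-2).  If d > 1 divided all
      the a_i but b and b', the partition function of the K - 1 multiples of d
      would be a sum of b b' values of D^2p.  It lives on the multiples of d, so it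
      is on average d times its mean there: a contradiction.
    - For k = 2, the integers Dp >= 1 tend to 1 / (a_1 a_2), so a_1 = a_2 = 1. *)

(** * Polynomials acting on integer sequences *)

(** A sequence stands for a formal power series and [act g u] for its product with [g]; thus
    [1 - 'X^m] acts as the backward difference of step m, with [u] read as zero at negative
    indices. *)
Definition act (g : {poly int}) (u : nat -> int) (n : nat) : int :=
  \sum_(j < n.+1) g`_j * u (n - j)%N.

Definition trunc (u : nat -> int) (n : nat) : {poly int} := \poly_(j < n.+1) u j.

Definition eqmodX (n : nat) (p q : {poly int}) :=
  forall j, (j <= n)%N -> p`_j = q`_j.

Lemma eqmodX_mul n p p' q q' :
  eqmodX n p p' -> eqmodX n q q' -> eqmodX n (p * q) (p' * q').
Proof.
move=> pp' qq' j jn; rewrite !coefM; apply: eq_bigr => i _.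
by rewrite pp' ?qq' //; have := ltn_ord i; lia.
Qed.

Lemma coef_trunc u n j : (j <= n)%N -> (trunc u n)`_j = u j.
Proof. by move=> jn; rewrite coef_poly ltnS jn. Qed.

Lemma actE g u n m : (m <= n)%N -> act g u m = (g * trunc u n)`_m.
Proof.
move=> mn; rewrite coefM; apply: eq_bigr => i _; rewrite coef_trunc //.
by have := ltn_ord i; lia.
Qed.

Lemma act_mul g h u n : act (g * h) u n = act g (act h u) n.
Proof.
rewrite !(actE _ _ (leqnn n)) -mulrA.
apply: (@eqmodX_mul n) (leqnn n) => // j jn.
by rewrite coef_trunc // -actE.
Qed.

Lemma eq_act g u v n : (forall m, (m <= n)%N -> u m = v m) -> act g u n = act g v n.
Proof. by move=> uv; apply: eq_bigr => i _; rewrite uv ?leq_subr. Qed.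

Lemma actB g h u n : act (g - h) u n = act g u n - act h u n.
Proof. by rewrite !(actE _ _ (leqnn n)) mulrBl coefB. Qed.

Lemma act_sum (I : Type) (r : seq I) (F : I -> {poly int}) u n :
  act (\sum_(i <- r) F i) u n = \sum_(i <- r) act (F i) u n.
Proof.
rewrite (actE _ _ (leqnn n)) mulr_suml coef_sum; apply: eq_bigr => i _.
by rewrite (actE _ _ (leqnn n)).
Qed.

Lemma act1 u n : act 1 u n = u n.
Proof. by rewrite (actE _ _ (leqnn n)) mul1r coef_trunc. Qed.

Lemma actXn m u n : act 'X^m u n = if (m <= n)%N then u (n - m)%N else 0.
Proof.
rewrite (actE _ _ (leqnn n)) coefXnM ltnNge; case: leqP => //= mn.
by rewrite coef_trunc // leq_subr.
Qed.

Lemma act_1subXn m u n :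
  act (1 - 'X^m) u n = u n - (if (m <= n)%N then u (n - m)%N else 0).
Proof. by rewrite actB act1 actXn. Qed.

(** A polynomial with constant term 1 is invertible as a power series. Identities can therefore be
    proved after clearing denominators. *)
Lemma act_inj (g : {poly int}) u v : g`_0 = 1 ->
  (forall n, act g u n = act g v n) -> forall n, u n = v n.
Proof.
move=> g0 guv; elim/ltn_ind => n IH; have := guv n.
rewrite /act !big_ord_recl g0 !mul1r !subn0.
rewrite (eq_bigr (fun i : 'I_n => g`_(lift ord0 i) * v (n - lift ord0 i)%N)).
  by move=> /addIr.
by move=> i _; rewrite IH //= /bump /=; have := ltn_ord i; lia.
Qed.

(** * Partition counts as power series coefficients *)

Definition delta (n : nat) : int := (n == 0)%N%:R.

(* The coefficient of [X^n] in [\prod_(x <- s) (1 - X^x)^-1], where each geometric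
   series may be cut at degree [n * x] since only positive [x] are used. *)
Definition ser (s : seq nat) (n : nat) : int :=
  (\prod_(x <- s) \sum_(c < n.+1) 'X^(c * x) : {poly int})`_n.

Definition den (s : seq nat) : {poly int} := \prod_(x <- s) (1 - 'X^x).

Lemma geo_trunc x m : (1 - 'X^x) * \sum_(c < m) 'X^(c * x) = 1 - 'X^(m * x) :> {poly int}.
Proof.
have -> : \sum_(c < m) 'X^(c * x) = \sum_(c < m) ('X^x) ^+ c :> {poly int}.
  by apply: eq_bigr => c _; rewrite mulnC exprM.
by rewrite -opprB mulNr -subrX1 mulnC exprM opprB.
Qed.

Lemma eqmodX_prod n (I : eqType) (r : seq I) (F F' : I -> {poly int}) :
  (forall i, i \in r -> eqmodX n (F i) (F' i)) ->
  eqmodX n (\prod_(i <- r) F i) (\prod_(i <- r) F' i).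
Proof.
move=> FF'; rewrite !big_seq; apply: (big_ind2 (eqmodX n)) => // p p' q q'.
exact: eqmodX_mul.
Qed.

(** As x >= 1, the terms with c > m only have degrees above m, so one cutoff n serves every m <=
    n. *)
Lemma ser_widen s n m : all (leq 1) s -> (m <= n)%N ->
  ser s m = (\prod_(x <- s) \sum_(c < n.+1) 'X^(c * x) : {poly int})`_m.
Proof.
move=> /allP s0 mn; apply: (@eqmodX_prod m) (leqnn m) => x /s0 x0 j jm.
rewrite -!(big_mkord xpredT (fun c => 'X^(c * x) : {poly int})).
rewrite [in RHS](big_cat_nat (n := m.+1)) //= coefD [X in _ + X]coef_sum.
rewrite [X in _ + X]big1_seq ?addr0 // => c; rewrite mem_index_iota => /andP[_ /andP[mc _]].
by rewrite coefXn; case: eqP => // jE; nia.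
Qed.

Lemma act_den_ser s n : all (leq 1) s -> act (den s) (ser s) n = delta n.
Proof.
move=> s0; rewrite (actE _ _ (leqnn n)).
have -> : (den s * trunc (ser s) n)`_n =
    (den s * \prod_(x <- s) \sum_(c < n.+1) 'X^(c * x))`_n.
  apply: (@eqmodX_mul n) (leqnn n) => // j jn.
  by rewrite coef_trunc // (ser_widen s0 jn).
rewrite -big_split /=.
have -> : delta n = (\prod_(x <- s) (1 : {poly int}))`_n by rewrite big1 // coef1.
move/allP: s0 => s0; apply: (@eqmodX_prod n) (leqnn n) => x /s0 x0 j jn.
(* The telescoped factor [1 - 'X^(n.+1 * x)] is 1 up to degree n. *)
rewrite geo_trunc coefB coefXn; case: eqP => [jE|_]; last by rewrite subr0.
by nia.
Qed.

Lemma den_cons x s : den (x :: s) = (1 - 'X^x) * den s.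
Proof. by rewrite /den big_cons. Qed.

Lemma coef0_1subXn x : (0 < x)%N -> (1 - 'X^x : {poly int})`_0 = 1.
Proof. by case: x => // x _; rewrite coefB coef1 coefXn subr0. Qed.

Lemma coef0_mul1 (p q : {poly int}) : p`_0 = 1 -> q`_0 = 1 -> (p * q)`_0 = 1.
Proof. by rewrite coef0M => -> ->. Qed.

Lemma den0 s : all (leq 1) s -> (den s)`_0 = 1.
Proof.
elim: s => [_|x s IH /= /andP[x0 s0]]; first by rewrite /den big_nil coef1.
by rewrite den_cons coef0_mul1 ?coef0_1subXn ?IH.
Qed.

Lemma ser_cons x s n : (0 < x)%N -> all (leq 1) s ->
  act (1 - 'X^x) (ser (x :: s)) n = ser s n.
Proof.
move=> x0 s0; move: n; apply: (act_inj (den0 s0)) => n.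
by rewrite -act_mul mulrC -den_cons !act_den_ser //= x0.
Qed.

Lemma perm_ser s t n : perm_eq s t -> ser s n = ser t n.
Proof. by move=> st; rewrite /ser (perm_big _ st). Qed.

Lemma ser_nil n : ser [::] n = delta n.
Proof. by rewrite /ser big_nil coef1. Qed.

Lemma ser_rec x s n : (0 < x)%N -> all (leq 1) s ->
  ser (x :: s) n = ser s n + (if (x <= n)%N then ser (x :: s) (n - x)%N else 0).
Proof. by move=> x0 s0; rewrite -(ser_cons n x0 s0) act_1subXn subrK. Qed.

Lemma ser_ge0 s n : 0 <= ser s n.
Proof.
suff H m j : 0 <= (\prod_(x <- s) \sum_(c < m) 'X^(c * x) : {poly int})`_j by exact: H.
elim: s j => [|x s IH] j; first by rewrite big_nil coef1.
rewrite big_cons coefM sumr_ge0 // => i _; rewrite mulr_ge0 //.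
by rewrite coef_sum sumr_ge0 // => c _; rewrite coefXn.
Qed.

Lemma ser_support (d : nat) s n : all (leq 1) s -> all (dvdn d) s -> ~~ (d %| n)%N -> ser s n = 0.
Proof.
elim: s n => [|x s IH] n /=.
  by move=> _ _ dn; rewrite ser_nil /delta; case: eqP dn => // ->; rewrite dvdn0.
move=> /andP[x0 s0] /andP[dx ds]; elim/ltn_ind: n => n IHn dn.
rewrite ser_rec // IH // add0r; case: leqP => // xn.
by rewrite IHn //; [lia | rewrite dvdn_subl].
Qed.

(** * Cumulative counts and their lower bound *)

Definition csum (u : nat -> int) (n : nat) : int := \sum_(m < n.+1) u m.

Lemma csumS u n : csum u n.+1 = csum u n + u n.+1.
Proof. exact: big_ord_recr. Qed.

Lemma csum0 u : csum u 0 = u 0%N.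
Proof. exact: big_ord1. Qed.

Lemma csum_ser_rec x s n : (0 < x)%N -> all (leq 1) s ->
  csum (ser (x :: s)) n =
  csum (ser s) n + (if (x <= n)%N then csum (ser (x :: s)) (n - x)%N else 0).
Proof.
move=> x0 s0; elim: n => [|n IH]; first by rewrite !csum0 ser_rec // leqNgt x0.
rewrite !csumS IH (ser_rec n.+1) //; case: (leqP x n) => xn.
  by rewrite leqW // (subSn xn) csumS; ring.
case: (leqP x n.+1) => xn1; last by ring.
have -> : (n.+1 - x = 0)%N by lia.
by rewrite csum0; ring.
Qed.

Lemma expr_sub_le (y a : int) k : 0 <= a <= y ->
  y ^+ k.+1 - (y - a) ^+ k.+1 <= k.+1%:R * a * y ^+ k.
Proof.
move=> /andP[a0 ay]; have y0 := le_trans a0 ay.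
elim: k => [|k IH]; first by rewrite !expr1 expr0; lia.
have -> : y ^+ k.+2 - (y - a) ^+ k.+2 =
   y * (y ^+ k.+1 - (y - a) ^+ k.+1) + a * (y - a) ^+ k.+1.
  by rewrite !(exprS _ k.+1); ring.
have -> : k.+2%:R * a * y ^+ k.+1 = y * (k.+1%:R * a * y ^+ k) + a * y ^+ k.+1.
  by rewrite -[k.+2]addn1 natrD !exprS; ring.
by apply: lerD; apply: ler_wpM2l => //; apply: lerXn2r; rewrite ?nnegrE; lia.
Qed.

(* A lattice-point count dominates the volume of the simplex
   [\sum_i x_i a_i <= n + 1]. *)
Lemma csum_ser_ge s n : all (leq 1) s ->
  (n.+1%:R ^+ size s : int) <= ((size s)`! * \prod_(x <- s) x)%:R * csum (ser s) n.
Proof.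
elim: s n => [|x s IH] n.
  rewrite /= big_nil expr0 mul1r => _.
  by rewrite /csum big_ord_recl big1 ?addr0 => [|i _]; rewrite ser_nil.
move=> /= /andP[x0 s0]; rewrite big_cons; set k := size s in IH *.
set p := \prod_(_ <- s) _ in IH *.
have E : (k.+1`! * (x * p))%:R = (k.+1%:R * x%:R) * (k`! * p)%:R :> int.
  by rewrite factS !natrM; ring.
elim/ltn_ind: n => n IHn; rewrite csum_ser_rec //.
have h2 : k.+1%:R * x%:R * n.+1%:R ^+ k <= (k.+1`! * (x * p))%:R * csum (ser s) n.
  by rewrite E -[X in _ <= X]mulrA; apply: ler_wpM2l (IH _ s0); rewrite mulr_ge0.
case: (leqP x n) => xn; last first.
  rewrite addr0; apply: le_trans h2.
  rewrite exprS; apply: ler_wpM2r; first exact: exprn_ge0.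
  by rewrite -natrM ler_nat; nia.
have := IHn (n - x)%N; rewrite mulrDr => /(_ ltac:(lia)) h1.
(* The left side grows from n - x to n by at most the share of [s] bounded in [h2]. *)
have := @expr_sub_le n.+1%:R x%:R k ltac:(lia).
have -> : n.+1%:R - x%:R = (n - x).+1%:R :> int by lia.
by move=> h3; apply: le_trans (lerD h2 h1); rewrite -lerBlDr.
Qed.

(** * Cyclotomic factors and a common denominator *)

Definition geom (x : nat) : {poly int} := \sum_(i < x) 'X^i.

Lemma geomE x : (1 - 'X) * geom x = 1 - 'X^x.
Proof. by rewrite -opprB mulNr -subrX1 opprB. Qed.

Lemma geom_horner1 x : (geom x).[1] = x%:R.
Proof.
rewrite /geom horner_sum (eq_bigr (fun=> 1)) ?sumr_const ?card_ord // => i _.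
by rewrite hornerXn expr1n.
Qed.

Lemma geom_Cyclotomic x : (0 < x)%N ->
  geom x = \prod_(d <- divisors x | (1 < d)%N) 'Phi_d.
Proof.
move=> x0; have X1 : ('X - 1 : {poly int}) != 0 by rewrite -polyC1 polyXsubC_eq0.
apply: (mulfI X1); rewrite -subrX1 -prod_Cyclotomic //.
rewrite (bigD1_seq 1%N) ?divisors_uniq //=; last by rewrite -dvdn_divisors.
congr (_ * _); first by have := @prod_Cyclotomic 1 isT; rewrite big_seq1.
rewrite big_seq_cond [RHS]big_seq_cond; apply: eq_bigl => d.
rewrite -dvdn_divisors //; case: d => [|[]] //=; rewrite ?andbF ?andbT //.
by rewrite dvd0n; case: x x0 X1.
Qed.

(** For d > 1, ['Phi_d] occurs [count (dvdn d) s] times in the product over [s], and e times in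
    [geom M ^+ e] when d divides M. The leftover powers form [G]. *)
Lemma geom_prod_dvd s M e : (0 < M)%N -> all (leq 1) s -> all (dvdn^~ M) s ->
  (forall d, (1 < d)%N -> (count (dvdn d) s <= e)%N) ->
  exists G : {poly int}, geom M ^+ e = G * \prod_(x <- s) geom x.
Proof.
move=> M0 s0 sM cnt.
exists (\prod_(d <- divisors M | (1 < d)%N) 'Phi_d ^+ (e - count (dvdn d) s)).
have -> : \prod_(x <- s) geom x =
    \prod_(x <- s) \prod_(d <- divisors M | (1 < d)%N) (if (d %| x)%N then 'Phi_d else 1).
  rewrite big_seq [RHS]big_seq; apply: eq_bigr => x xs.
  rewrite geom_Cyclotomic ?(allP s0 _ xs) // -big_mkcondr.
  rewrite -big_filter -[RHS]big_filter; apply: perm_big; apply: uniq_perm.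
  - by rewrite filter_uniq ?divisors_uniq.
  - by rewrite filter_uniq ?divisors_uniq.
  have x0 : (0 < x)%N := allP s0 _ xs.
  move=> d; rewrite !mem_filter -(dvdn_divisors _ x0) -(dvdn_divisors _ M0) /= -andbA.
  congr (_ && _).
  case: (boolP (d %| x)%N) => //= dx; apply/esym.
  exact: dvdn_trans dx (allP sM _ xs).
rewrite exchange_big -big_split geom_Cyclotomic // -prodrXl.
apply: eq_bigr => d d1; rewrite -big_mkcond big_const_seq iter_mulr_1.
by rewrite /= -exprD subnK ?cnt.
Qed.

(** The coefficients of 1 / ((1 - X) (1 - X^M)^e) in closed form. *)
Definition binw (M e n : nat) : int := 'C(n %/ M + e, e)%:R.

Lemma act_binwS M e n : (0 < M)%N -> act (1 - 'X^M) (binw M e.+1) n = binw M e n.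
Proof.
move=> M0; rewrite act_1subXn /binw; case: leqP => Mn; last first.
  by rewrite divn_small // !add0n !binn subr0.
have -> : (n %/ M)%N = ((n - M) %/ M).+1.
  by rewrite -{1}(subnK Mn) divnDr // divnn M0 addn1.
by rewrite !addSn !addnS binS natrD; ring.
Qed.

Lemma act_binw M e n : (0 < M)%N -> act ((1 - 'X) * (1 - 'X^M) ^+ e) (binw M e) n = delta n.
Proof.
move=> M0; elim: e n => [|e IH] n.
  rewrite expr0 mulr1 -['X]expr1 act_1subXn /binw !bin0 /delta.
  by case: n => // n; rewrite subrr.
rewrite exprSr mulrA act_mul -IH; apply: eq_act => m _; exact: act_binwS.
Qed.

Lemma binw_den0 M e : (0 < M)%N -> ((1 - 'X) * (1 - 'X^M) ^+ e : {poly int})`_0 = 1.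
Proof.
move=> M0; apply: coef0_mul1; first by rewrite coefB coef1 coefX subr0.
elim: e => [|e IH]; first by rewrite expr0 coef1.
by rewrite exprS; apply: coef0_mul1 IH; apply: coef0_1subXn.
Qed.

Lemma den_geom s : den s = (1 - 'X) ^+ size s * \prod_(x <- s) geom x.
Proof.
rewrite /den (eq_bigr (fun x => (1 - 'X) * geom x)) => [|x _]; last by rewrite geomE.
by rewrite big_split big_const_seq iter_mulr_1 count_predT.
Qed.

Lemma prod_ge1 s : all (leq 1) s -> (0 < \prod_(x <- s) x)%N.
Proof. by move=> s0; rewrite big_seq prodn_cond_gt0 // => x /(allP s0). Qed.

Lemma dvdn_prod_seq s : all (dvdn^~ (\prod_(x <- s) x)%N) s.
Proof. by apply/allP => x xs; rewrite (big_rem x) //= dvdn_mulr. Qed.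

(* Partial fractions, without roots of unity: all the poles of
   [(1 - X)^(k - 1 - e) * \prod_(x <- s) (1 - X^x)^-1] other than [1] have order
   at most [e], so that [(1 - X) * (1 - X^M) ^ e] is a common denominator. *)
Lemma act_ser_binw s e : (e < size s)%N -> all (leq 1) s ->
  (forall d, (1 < d)%N -> (count (dvdn d) s <= e)%N) ->
  let M := (\prod_(x <- s) x)%N in
  exists2 G : {poly int}, M%:R ^+ e = G.[1] * M%:R &
  forall n, act ((1 - 'X) ^+ (size s - 1 - e)) (ser s) n = act G (binw M e) n.
Proof.
move=> es s0 cnt M; have M0 : (0 < M)%N := prod_ge1 s0.
have [G GE] := geom_prod_dvd M0 s0 (dvdn_prod_seq s) cnt.
exists G.
  (* The value of [G] at 1 comes from evaluating the factorization there, where [geom x] equals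
     x. *)
  rewrite -(geom_horner1 M) -horner_exp GE hornerM horner_prod geom_horner1.
  by congr (_ * _); rewrite /M natr_prod; apply: eq_bigr => x _; rewrite geom_horner1.
pose g : {poly int} := (1 - 'X) * (1 - 'X^M) ^+ e.
apply: (act_inj (g := g) (binw_den0 e M0)) => n.
rewrite -!act_mul (mulrC g G) [RHS]act_mul.
rewrite [RHS](eq_act _ (v := delta)) => [|m _]; last exact: (act_binw e m M0).
have -> : g * (1 - 'X) ^+ (size s - 1 - e) = G * den s.
  rewrite /g -geomE exprMn GE den_geom.
  have : size s = (1 + e + (size s - 1 - e))%N by lia.
  by move: (size s - 1 - e)%N => t ->; rewrite !exprD expr1; ring.
by rewrite act_mul; apply: eq_act => m _; rewrite act_den_ser.
Qed.

(** * Lists of parts: splitting and gcd conditions *)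

Lemma pA_ser a n k : (pA a n k)%:R = ser [seq a (nat_of_ord i) | i : 'I_k] n.
Proof.
rewrite /ser big_image /= bigA_distr_bigA /= coef_sum.
under eq_bigr => f _ do rewrite prodrXr coefXn.
rewrite -natr_sum -big_mkcond sum1dep_card /pA; congr (#|pred_of_set _|%:R).
by apply/setP => f; rewrite !inE eq_sym.
Qed.

(** At most m elements fail [p]; [t] takes all of them and is filled up to length exactly m with
    elements satisfying [p]. *)
Lemma perm_split_count (T : eqType) (p : pred T) (s : seq T) m :
  (m <= size s)%N -> (size s <= count p s + m)%N ->
  exists t s', [/\ perm_eq s (t ++ s'), size t = m & all p s'].
Proof.
move=> ms cm; pose r := [seq x <- s | predC p x] ++ [seq x <- s | p x].
have sr : perm_eq s r by rewrite perm_sym perm_catC perm_filterC.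
exists (take m r), (drop m r); rewrite cat_take_drop.
rewrite size_takel -?(perm_size sr) //; split=> //.
have cs : (size [seq x <- s | predC p x] <= m)%N.
  by rewrite size_filter -(leq_add2l (count p s)) count_predC.
rewrite drop_cat ltnNge cs /=.
by apply/allP => x /mem_drop; rewrite mem_filter => /andP[].
Qed.

Lemma act_geom b u n : act (geom b) u n =
  \sum_(i < b) (if (i <= n)%N then u (n - i)%N else 0).
Proof. by rewrite /geom act_sum; apply: eq_bigr => i _; rewrite actXn. Qed.

Lemma act_geom_le (R : numDomainType) b u (B : R) N n :
  (forall m, (N <= m <= n)%N -> (u m)%:~R <= B) -> (N + b <= n)%N ->
  (act (geom b) u n)%:~R <= b%:R * B.
Proof.
move=> uB Nbn; rewrite act_geom rmorph_sum /= mulr_natl -[b in _ *+ b]card_ord.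
rewrite -sumr_const; apply: ler_sum => i _; have := ltn_ord i => ib.
by rewrite (_ : i <= n)%N ?uB //; lia.
Qed.

(** Removing b and c multiplies the series by (1 - X^b) (1 - X^c) =
    [geom b * geom c * (1 - 'X) ^+ 2], so [ser s] is a sum of bc second differences of the full
    count. *)
Lemma ser_cons2 b c s n : all (leq 1) (b :: c :: s) ->
  ser s n = act (geom b) (act (geom c) (act ((1 - 'X) ^+ 2) (ser (b :: c :: s)))) n.
Proof.
move=> /= /and3P[b0 c0 s0]; rewrite -!act_mul.
have -> : geom b * geom c * (1 - 'X) ^+ 2 = (1 - 'X^c) * (1 - 'X^b).
  by rewrite -!geomE; ring.
rewrite act_mul -(ser_cons _ c0 s0); apply: eq_act => m _.
by rewrite ser_cons //= c0.
Qed.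

Lemma count_image_card (a : nat -> nat) k (p : pred nat) :
  count p [seq a (nat_of_ord i) | i : 'I_k] = #|[set i : 'I_k | p (a i)]|.
Proof. by rewrite count_map -sum1_count big_enum_cond -sum1dep_card. Qed.

(** If d > 1 divides m of the parts, it divides the gcd over their indices; conversely a gcd above 1
    is itself such a d. *)
Lemma gcd_sub_count (a : nat -> nat) k m : (forall i, 0 < a i)%N -> (0 < m)%N ->
  (forall S : {set 'I_k}, #|S| = m -> gcd_sub a S = 1%N) <->
  (forall d, (1 < d)%N -> (count (dvdn d) [seq a (nat_of_ord i) | i : 'I_k] < m)%N).
Proof.
move=> a0 m0; split=> [gcd1 d d1 | cnt S Sm].
  rewrite count_image_card ltnNge; apply/negP => /card_geqP[s [us sm ss]].
  have : #|[set i in s]| = m by rewrite cardsE (card_uniqP us).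
  move/gcd1 => g1; suff : (d %| 1)%N by rewrite dvdn1; lia.
  rewrite -g1 /gcd_sub; apply/dvdn_biggcdP => i; rewrite inE => /ss.
  by rewrite inE.
have gS i : i \in S -> (gcd_sub a S %| a i)%N by move=> iS; apply: (biggcdn_inf i).
(* The empty gcd is 0 by convention; m > 0 keeps [S] nonempty. *)
have [i iS] : exists i, i \in S by apply/set0Pn; rewrite -card_gt0 Sm.
have g0 : (0 < gcd_sub a S)%N.
  by rewrite lt0n; apply/eqP => g0; have := gS i iS; rewrite g0 dvd0n; have := a0 i; lia.
apply/eqP; rewrite eqn_leq g0 andbT leqNgt; apply/negP => /cnt.
rewrite count_image_card ltnNge -Sm; move/negP; apply.
by apply/subset_leq_card/fintype.subsetP => j /gS; rewrite inE.
Qed.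

Local Open Scope classical_set_scope.
Local Open Scope ring_scope.

(** * Limits of differences of partition counts *)

Section Asymptotics.
Variable R : realType.

Lemma cvg_invn : (n%:R^-1 : R) @[n --> \oo] --> (0 : R).
Proof.
apply/gtr0_cvgV0; last exact: cvgr_idn.
by near=> n; rewrite ltr0n; near: n; exists 1%N.
Unshelve. all: by end_near. Qed.

Lemma cvg_divn (M i j : nat) : (0 < M)%N ->
  (((n - j) %/ M + i)%N%:R / n%:R : R) @[n --> \oo] --> (M%:R^-1 : R).
Proof.
move=> M0; have M0' : (0 : R) < M%:R by rewrite ltr0n.
apply: (squeeze_cvgr (f := fun n => M%:R^-1 - (j + M)%:R * n%:R^-1 : R)
          (h := fun n => M%:R^-1 + i%:R * n%:R^-1 : R)).
- near=> n; have n0 : (0 < n)%N by near: n; exists 1%N.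
  have n0' : (0 : R) < n%:R by rewrite ltr0n.
  have h := divn_eq (n - j) M; have h' := ltn_pmod (n - j) M0.
  set q := ((n - j) %/ M)%N in h *.
  have E1 : M%:R^-1 = (n%:R / M%:R) / n%:R :> R by rewrite mulrAC divff ?mul1r ?gt_eqF.
  rewrite E1 -mulrBl -mulrDl !ler_pM2r ?invr_gt0 //.
  apply/andP; split.
    by rewrite lerBlDr ler_pdivrMr // -!(natrD, natrM) ler_nat; nia.
  by rewrite natrD lerD2r ler_pdivlMr // -natrM ler_nat; nia.
- rewrite -[X in _ --> X]subr0 -[X in _ - X](mulr0 (j + M)%:R).
  by apply: cvgB; [exact: cvg_cst|apply: cvgMr; exact: cvg_invn].
- rewrite -[X in _ --> X]addr0 -[X in _ + X](mulr0 i%:R).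
  by apply: cvgD; [exact: cvg_cst|apply: cvgMr; exact: cvg_invn].
Unshelve. all: by end_near. Qed.

Lemma cvg_near_eq (f g : nat -> R) (l : R) : (\forall n \near \oo, g n = f n) ->
  f n @[n --> \oo] --> l -> g n @[n --> \oo] --> l.
Proof.
move=> gf; apply: cvg_trans; apply: near_eq_cvg.
by apply: filterS gf => n ->.
Qed.

Lemma cvg_eq (f g : nat -> R) (l : R) : (forall n, g n = f n) ->
  f n @[n --> \oo] --> l -> g n @[n --> \oo] --> l.
Proof. by move=> gf; apply: cvg_near_eq; apply: nearW. Qed.

(** With q the quotient, the binomial is the product of (q + i) / i for 1 <= i <= e, and each (q +
    i) / n tends to 1 / M whatever the shift j. *)
Lemma cvg_binw (M e j : nat) : (0 < M)%N ->
  ((binw M e (n - j))%:~R / n%:R ^+ e : R) @[n --> \oo] --> ((M%:R ^+ e * e`!%:R)^-1 : R).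
Proof.
move=> M0; rewrite /binw.
pose c e n : R := 'C((n - j) %/ M + e, e)%:R / n%:R ^+ e.
apply: (@cvg_eq (c e)) => [n|]; first by rewrite /c natz -pmulrn.
elim: e => [|e IH].
  rewrite expr0 mul1r invr1; apply: (@cvg_eq (fun=> 1)); last exact: cvg_cst.
  by move=> n; rewrite /c addn0 bin0 expr0 divr1.
rewrite exprS factS natrM.
have -> : (M%:R * M%:R ^+ e * (e.+1%:R * e`!%:R))^-1 =
    (M%:R ^+ e * e`!%:R)^-1 * M%:R^-1 * e.+1%:R^-1 :> R.
  by rewrite -!invfM; congr (_^-1); ring.
apply: (@cvg_eq (fun n => c e n * (((n - j) %/ M + e.+1)%:R / n%:R) * e.+1%:R^-1)).
  move=> n; rewrite /c; set q := ((n - j) %/ M)%N.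
  have e1 : (e.+1%:R : R) != 0 by rewrite pnatr_eq0.
  apply: (mulIf e1); rewrite mulfVK //.
  have := mul_bin_diag (q + e.+1) e; rewrite addnS /= => h.
  rewrite exprSr invfM mulrACA -natrM mulrAC -natrM; congr (_ %:R * _).
  by rewrite mulnC -h mulnC.
by apply: cvgM; [apply: cvgM; [exact: IH|exact: cvg_divn]|exact: cvg_cst].
Qed.

Lemma cvg_sumr (I : Type) (r : seq I) (f : I -> nat -> R) (l : I -> R) :
  (forall i, f i n @[n --> \oo] --> l i) ->
  (\sum_(i <- r) f i n : R) @[n --> \oo] --> (\sum_(i <- r) l i : R).
Proof.
move=> fl; elim: r => [|i r IH].
  by rewrite big_nil; apply: (@cvg_eq (fun=> 0)) => [n|]; [rewrite big_nil|exact: cvg_cst].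
rewrite big_cons; apply: (@cvg_eq (fun n => f i n + \sum_(j <- r) f j n)) => [n|].
  by rewrite big_cons.
by apply: cvgD.
Qed.

(** For large n the action is a fixed finite combination of shifts of [u], all with limit l, and the
    coefficients of [G] add up to [G.[1]]. *)
Lemma cvg_act (G : {poly int}) (u : nat -> int) (e : nat) (l : R) :
  (forall j, ((u (n - j)%N)%:~R / n%:R ^+ e : R) @[n --> \oo] --> l) ->
  ((act G u n)%:~R / n%:R ^+ e : R) @[n --> \oo] --> (G.[1]%:~R * l : R).
Proof.
move=> ul; rewrite horner_coef rmorph_sum /= mulr_suml.
rewrite -(big_mkord xpredT (fun j => (G`_j * 1 ^+ j)%:~R * l)).
apply: (@cvg_near_eq (fun n => \sum_(0 <= j < size G)
    (G`_j)%:~R * ((u (n - j)%N)%:~R / n%:R ^+ e))); last first.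
  by apply: cvg_sumr => j; rewrite expr1n mulr1; apply: cvgMr; exact: ul.
near=> n.
have sn : (size G <= n.+1)%N by near: n; exists (size G) => // n /= h; exact: leqW.
rewrite /act -(big_mkord xpredT (fun j => G`_j * u (n - j)%N)).
rewrite (big_cat_nat (n := size G)) //= [X in _ + X]big_nat_cond [X in _ + X]big1 ?addr0.
  rewrite rmorph_sum /= mulr_suml; apply: eq_bigr => j _.
  by rewrite rmorphM /= mulrA.
by move=> j /andP[/andP[gj _] _]; rewrite nth_default ?mul0r.
Unshelve. all: by end_near. Qed.

Lemma cvg_act_ser (s : seq nat) (e : nat) : (e < size s)%N -> all (leq 1) s ->
  (forall d, (1 < d)%N -> (count (dvdn d) s <= e)%N) ->
  ((act ((1 - 'X) ^+ (size s - 1 - e)) (ser s) n)%:~R / n%:R ^+ e : R) @[n --> \oo]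
    --> ((e`! * \prod_(x <- s) x)%:R^-1 : R).
Proof.
move=> es s0 cnt; have [G GM GE] := act_ser_binw es s0 cnt.
have M0 := prod_ge1 s0; set M := (\prod_(x <- s) x)%N in GM GE M0 *.
apply: (@cvg_eq (fun n => (act G (binw M e) n)%:~R / n%:R ^+ e)) => [n|].
  by rewrite GE.
(* By M^e = G(1) M, the factor G(1) cancels. *)
have -> : ((e`! * M)%:R^-1 : R) = G.[1]%:~R * (M%:R ^+ e * e`!%:R)^-1.
  have M0' : (M%:R : R) != 0 by rewrite pnatr_eq0 -lt0n.
  have e0' : (e`!%:R : R) != 0 by rewrite pnatr_eq0 -lt0n fact_gt0.
  have /(congr1 (fun z : int => z%:~R : R)) := GM.
  rewrite rmorphXn rmorphM /= !natz -!pmulrn => ->.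
  have G1 : (G.[1]%:~R : R) != 0.
    apply/eqP => g0; move/eqP: GM; rewrite (_ : G.[1] = 0) ?mul0r.
      by rewrite expf_eq0 pnatr_eq0 => /andP[_ /eqP M00]; rewrite M00 in M0.
    by apply/eqP; rewrite -(intr_eq0 R) g0.
  by rewrite natrM; field; rewrite M0' e0' G1.
apply: cvg_act => j; exact: cvg_binw.
Qed.

End Asymptotics.

(** * Bounds for real powers near 1 *)

Section PowerBounds.
Variable R : realType.

Lemma powR_expR_ln (x a : R) : 0 < x -> x `^ a = expR (a * ln x).
Proof. by move=> x0; rewrite /powR gt_eqF. Qed.

Lemma powR_1sub_le (t a : R) : 0 <= t < 1 -> 0 <= a ->
  (1 - t) `^ a <= (1 + a * t)^-1.
Proof.
move=> /andP[t0 t1] a0; rewrite powR_expR_ln ?subr_gt0 //.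
have ln_le : ln (1 - t) <= - t by apply: le_ln1Dx; rewrite ltrN2.
have at0 : 0 < 1 + a * t by rewrite ltr_wpDr // mulr_ge0.
rewrite -[expR _]invrK -expRN lef_pV2 ?posrE ?expR_gt0 //.
apply: le_trans (expR_ge1Dx _); rewrite lerD2l -mulrN ler_wpM2l //.
by rewrite lerNr.
Qed.

(** Combines exp(x) >= 1 + x with -ln(1 - t) = ln(1 + t / (1 - t)) <= t / (1 - t). *)
Lemma powR_1sub_ge (t a : R) : 0 <= t < 1 -> 0 <= a ->
  1 - a * (t / (1 - t)) <= (1 - t) `^ a.
Proof.
move=> /andP[t0 t1] a0; have t1' : 0 < 1 - t by rewrite subr_gt0.
rewrite powR_expR_ln //; apply: le_trans (expR_ge1Dx _).
rewrite lerD2l -mulrN ler_wpM2l // -[ln _]opprK lerN2 -lnV ?posrE //.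
have E : (1 - t)^-1 = 1 + t / (1 - t) by field; rewrite gt_eqF.
by rewrite [X in ln X]E; apply: le_ln1Dx; apply: lt_le_trans (ltrN10 _) _; rewrite divr_ge0 // ltW.
Qed.

(** Because (n + 1) (n - 1) = (1 - n^-2) n^2, the three weights collapse to one factor. *)
Lemma powR_logconcaveE (n : nat) (a x y z : R) : (2 <= n)%N ->
  (y / n.+1%:R `^ a * (z / n.-1%:R `^ a) < (x / n%:R `^ a) ^+ 2) =
  (y * z < x ^+ 2 * (1 - n%:R ^- 2) `^ a).
Proof.
case: n => [|[|n]] // _ /=; set m := n.+2.
have m0 : (0 : R) < m%:R by rewrite ltr0n.
have E : n.+3%:R * n.+1%:R = (1 - m%:R ^- 2) * m%:R ^+ 2 :> R.
  rewrite mulrBl mul1r mulVf ?expf_neq0 ?gt_eqF //.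
  by rewrite /m -[n.+3]addn1 -[n.+2]addn1 -[n.+1]addn1 !natrD; ring.
have t1 : 0 <= 1 - m%:R ^- 2 :> R.
  by rewrite subr_ge0 invf_le1 ?exprn_gt0 // exprn_ege1 // ler1n.
have E' : n.+3%:R `^ a * n.+1%:R `^ a = (1 - m%:R ^- 2) `^ a * (m%:R `^ a) ^+ 2 :> R.
  by rewrite -powRM // E powRM ?exprn_ge0 // !expr2 powRM.
rewrite mulrACA -invfM E' exprMn exprVn ltr_pdivrMr; last first.
  by rewrite -E' mulr_gt0 ?powR_gt0 ?ltr0n.
have m1 : m%:R `^ a != 0 :> R by rewrite gt_eqF // powR_gt0.
by congr (_ < _); field.
Qed.

Lemma inv_sqr_itv (n : nat) : (2 <= n)%N -> 0 <= (n%:R ^- 2 : R) < 1.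
Proof.
move=> n2; rewrite invr_ge0 exprn_ge0 //= invf_lt1 ?exprn_gt0 ?ltr0n ?(leq_trans _ n2) //.
by rewrite exprn_egt1 // ltr1n.
Qed.

End PowerBounds.

(** * Log-concavity of real sequences asymptotic to c n^K *)

Section LogConcavity.
(** [U], [V] and [F] stand for the forward, backward and second differences of [P]. Multiplying by n
    or n^2 before dividing by n^K avoids the truncated exponents K - 1 and K - 2. *)
Variables (R : realType) (K : nat) (c : R) (P U V F : nat -> R).
Hypothesis c0 : 0 < c.
Hypothesis Pc : P n / n%:R ^+ K @[n --> \oo] --> c.
Hypothesis Uc : U n * n%:R / n%:R ^+ K @[n --> \oo] --> c * K%:R.
Hypothesis Vc : V n * n%:R / n%:R ^+ K @[n --> \oo] --> c * K%:R.

Lemma cvg_sqr_ratio (a : R) :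
  (n%:R ^+ 2 / (n%:R ^+ 2 + a) : R) @[n --> \oo] --> (1 : R).
Proof.
have h : 1 + a * (n%:R^-1 * n%:R^-1) @[n --> \oo] --> (1 : R).
  rewrite -[X in _ --> X]addr0 -(mulr0 a) -[X in a * X](mulr0 0).
  apply: cvgD; first exact: cvg_cst.
  by apply: cvgMr; apply: cvgM; exact: cvg_invn.
rewrite -[X in _ --> X]invr1.
apply: (@cvg_near_eq _ (fun n => (1 + a * (n%:R^-1 * n%:R^-1))^-1)); last first.
  by apply: cvgV => //; exact: oner_neq0.
near=> n; have n0 : (n%:R : R) != 0.
  by rewrite pnatr_eq0 -lt0n; near: n; exists 1%N.
have -> : 1 + a * (n%:R^-1 * n%:R^-1) = (n%:R ^+ 2 + a) / n%:R ^+ 2 :> R by field.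
by rewrite invf_div.
Unshelve. all: by end_near. Qed.

(** The subtracted term is P^2 b / (n^2 + a) rescaled, the loss due to (1 - n^-2)^alpha: the lower
    bound of that power uses (a, b) = (-1, alpha), the upper bound (alpha, alpha). *)
Lemma cvg_logconcavity_defect (a b : R) :
  (U n * n%:R / n%:R ^+ K) * (V n * n%:R / n%:R ^+ K)
  - (P n / n%:R ^+ K) ^+ 2 * (b * (n%:R ^+ 2 / (n%:R ^+ 2 + a))) @[n --> \oo]
  --> c ^+ 2 * (K%:R ^+ 2 - b).
Proof.
have -> : c ^+ 2 * (K%:R ^+ 2 - b) = c * K%:R * (c * K%:R) - c * c * (b * 1) by ring.
apply: cvgB; first exact: cvgM.
apply: cvgM; last by apply: cvgMr; exact: cvg_sqr_ratio.
by under eq_fun do rewrite expr2; exact: cvgM.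
Qed.

(** With F = U - V, P^2 - (P + U) (P - V) = U V - P F, whose rescaled limit is c^2 K^2 - c^2 K (K -
    1) = c^2 K; the power costs c^2 a. *)
Lemma logconcave_of_cvg (a : R) :
  (\forall n \near \oo, P n.+1 = P n + U n) ->
  (\forall n \near \oo, P n.-1 = P n - V n) ->
  (\forall n \near \oo, F n = U n - V n) ->
  F n * n%:R ^+ 2 / n%:R ^+ K @[n --> \oo] --> c * (K%:R * (K%:R - 1)) ->
  0 <= a < K%:R ->
  \forall n \near \oo, P n.+1 * P n.-1 < P n ^+ 2 * (1 - n%:R ^- 2) `^ a.
Proof.
move=> PU PV FUV Fc /andP[a0 aK].
have L : (U n * n%:R / n%:R ^+ K) * (V n * n%:R / n%:R ^+ K)
  - (P n / n%:R ^+ K) ^+ 2 * (a * (n%:R ^+ 2 / (n%:R ^+ 2 + -1)))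
  - (P n / n%:R ^+ K) * (F n * n%:R ^+ 2 / n%:R ^+ K)
  @[n --> \oo] --> c ^+ 2 * (K%:R - a).
  have -> : c ^+ 2 * (K%:R - a) = c ^+ 2 * (K%:R ^+ 2 - a)
     - c * (c * (K%:R * (K%:R - 1))) by ring.
  by apply: cvgB; [exact: cvg_logconcavity_defect|exact: cvgM].
have cKa : 0 < c ^+ 2 * (K%:R - a) by rewrite mulr_gt0 ?exprn_gt0 ?subr_gt0.
near=> n.
have n2 : (2 <= n)%N by near: n; exists 2%N.
have n0 : (0 : R) < n%:R by rewrite ltr0n (leq_trans _ n2).
have -> : P n.+1 = P n + U n by near: n.
have -> : P n.-1 = P n - V n by near: n.
have FE : F n = U n - V n by near: n.
have h : 0 < (U n * n%:R / n%:R ^+ K) * (V n * n%:R / n%:R ^+ K)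
  - (P n / n%:R ^+ K) ^+ 2 * (a * (n%:R ^+ 2 / (n%:R ^+ 2 + -1)))
  - (P n / n%:R ^+ K) * (F n * n%:R ^+ 2 / n%:R ^+ K).
  by near: n; exact: cvgr_gt L _ cKa.
have n1 : 0 < n%:R ^+ 2 - 1 :> R by rewrite subr_gt0 exprn_egt1 // ltr1n.
have nK : 0 < n%:R ^+ K :> R by rewrite exprn_gt0.
apply: lt_le_trans (ler_wpM2l (sqr_ge0 _) (powR_1sub_ge (inv_sqr_itv _ n2) a0)).
have -> : n%:R ^- 2 / (1 - n%:R ^- 2) = (n%:R ^+ 2 - 1)^-1 :> R.
  by field; rewrite !gt_eqF.
rewrite -subr_gt0.
have -> : P n ^+ 2 * (1 - a * (n%:R ^+ 2 - 1)^-1) - (P n + U n) * (P n - V n) =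
  ((U n * n%:R / n%:R ^+ K) * (V n * n%:R / n%:R ^+ K)
  - (P n / n%:R ^+ K) ^+ 2 * (a * (n%:R ^+ 2 / (n%:R ^+ 2 + -1)))
  - (P n / n%:R ^+ K) * (F n * n%:R ^+ 2 / n%:R ^+ K)) * (n%:R ^+ K) ^+ 2 / n%:R ^+ 2.
  by rewrite FE; field; rewrite !gt_eqF.
by rewrite divr_gt0 ?mulr_gt0 ?exprn_gt0.
Unshelve. all: by end_near. Qed.

(** The same identity read backwards: P F is below U V minus the loss a P^2 / (n^2 + a), and P is
    about c n^K. Keeping a / 2 instead of a leaves room for the error terms. *)
Lemma second_difference_le (a : R) : 0 < a ->
  (\forall n \near \oo, P n.+1 = P n + U n) ->
  (\forall n \near \oo, P n.-1 = P n - V n) ->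
  (\forall n \near \oo, F n = U n - V n) ->
  (\forall n \near \oo, P n.+1 * P n.-1 < P n ^+ 2 * (1 - n%:R ^- 2) `^ a) ->
  \forall n \near \oo, F n * n%:R ^+ 2 <= c * (K%:R ^+ 2 - a / 2) * n%:R ^+ K.
Proof.
move=> a0 PU PV FUV LC; set B := c * (K%:R ^+ 2 - a / 2).
have L : (P n / n%:R ^+ K) * B - ((U n * n%:R / n%:R ^+ K) * (V n * n%:R / n%:R ^+ K)
  - (P n / n%:R ^+ K) ^+ 2 * (a * (n%:R ^+ 2 / (n%:R ^+ 2 + a))))
  @[n --> \oo] --> c ^+ 2 * (a / 2).
  have -> : c ^+ 2 * (a / 2) = c * B - c ^+ 2 * (K%:R ^+ 2 - a) by rewrite /B; field.
  by apply: cvgB; [exact: cvgMl|exact: cvg_logconcavity_defect].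
have ca : 0 < c ^+ 2 * (a / 2) by rewrite mulr_gt0 ?exprn_gt0 ?divr_gt0.
near=> n.
have n2 : (2 <= n)%N by near: n; exists 2%N.
have n0 : (0 : R) < n%:R by rewrite ltr0n (leq_trans _ n2).
have nK : 0 < n%:R ^+ K :> R by rewrite exprn_gt0.
have : P n.+1 * P n.-1 < P n ^+ 2 * (1 - n%:R ^- 2) `^ a by near: n.
have -> : P n.+1 = P n + U n by near: n.
have -> : P n.-1 = P n - V n by near: n.
have FE : F n = U n - V n by near: n.
have P0 : 0 < P n / n%:R ^+ K by near: n; exact: cvgr_gt Pc _ c0.
have h : 0 < (P n / n%:R ^+ K) * B - ((U n * n%:R / n%:R ^+ K) * (V n * n%:R / n%:R ^+ K)
  - (P n / n%:R ^+ K) ^+ 2 * (a * (n%:R ^+ 2 / (n%:R ^+ 2 + a)))).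
  by near: n; exact: cvgr_gt L _ ca.
have na : 0 < n%:R ^+ 2 + a :> R by rewrite addr_gt0 ?exprn_gt0.
move/lt_le_trans => /(_ _ (ler_wpM2l (sqr_ge0 _) (powR_1sub_le (inv_sqr_itv _ n2) (ltW a0)))).
have -> : (1 + a * n%:R ^- 2)^-1 = 1 - a / (n%:R ^+ 2 + a) :> R.
  by field; rewrite (gt_eqF n0) gt_eqF // mulrC addrC.
move=> lc; rewrite -ler_pdivrMr // -(ler_pM2l P0) ltW // -subr_gt0.
pose A := P n ^+ 2 * (1 - a / (n%:R ^+ 2 + a)) - (P n + U n) * (P n - V n).
have A0 : 0 < A * n%:R ^+ 2 / (n%:R ^+ K) ^+ 2.
  by rewrite divr_gt0 ?mulr_gt0 ?exprn_gt0 // subr_gt0.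
have := addr_gt0 A0 h; congr (0 < _); rewrite FE /A; field.
by rewrite !gt_eqF.
Unshelve. all: by end_near. Qed.

(** The quotient [q] is eventually log-concave, so one drop would force geometric decay, against the
    limit c > 0. Hence [q] is eventually nondecreasing and stays below c. *)
Lemma le_limit_of_logconcave :
  (\forall n \near \oo, 0 < P n) ->
  (\forall n \near \oo, P n.+1 * P n.-1 < P n ^+ 2 * (1 - n%:R ^- 2) ^+ K) ->
  \forall n \near \oo, P n <= c * n%:R ^+ K.
Proof.
move=> P0 LC; pose q n := P n / n%:R ^+ K.
have [N _ HN] : \forall n \near \oo, 0 < q n /\ q n.+2 * q n <= q n.+1 ^+ 2.
  have LC' : \forall n \near \oo, P n.+2 * P n < P n.+1 ^+ 2 * (1 - n.+1%:R ^- 2) ^+ K.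
    by case: LC => N _ HN; exists N => // n /= h; apply: (HN n.+1); exact: leqW.
  near=> n; have n0 : (0 < n)%N by near: n; exists 1%N.
  have n0' : (0 : R) < n%:R by rewrite ltr0n.
  split; first by rewrite /q divr_gt0 ?exprn_gt0 //; near: n.
  have lc : P n.+2 * P n < P n.+1 ^+ 2 * (1 - n.+1%:R ^- 2) ^+ K by near: n.
  have m0 : (0 : R) < n.+1%:R by rewrite ltr0n.
  have /andP[_ t1] := inv_sqr_itv R (n0 : (2 <= n.+1)%N).
  have E : n.+2%:R * n%:R = (1 - n.+1%:R ^- 2) * n.+1%:R ^+ 2 :> R.
    rewrite mulrBl mul1r mulVf ?expf_neq0 ?gt_eqF //.
    by rewrite -[n.+2]addn1 -[n.+1]addn1 !natrD; ring.
  have Kpos : 0 < (1 - n.+1%:R ^- 2) ^+ K :> R by rewrite exprn_gt0 // subr_gt0.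
  rewrite /q mulrACA -invfM -exprMn E exprMn invfM mulrA.
  rewrite ler_pdivrMr ?exprn_gt0 // ler_pdivrMr //.
  rewrite exprMn exprVn -[n.+1%:R ^+ 2 ^+ K]exprM mulnC exprM.
  by rewrite mulfVK ?expf_neq0 ?gt_eqF // ltW.
have incr n : (N <= n)%N -> q n <= q n.+1.
  move=> Nn; rewrite leNgt; apply/negP => qlt.
  have [qn0 _] := HN n Nn.
  pose r := q n.+1 / q n; have r1 : r < 1 by rewrite /r ltr_pdivrMr // mul1r.
  have step m : q (n + m).+1 <= r * q (n + m)%N.
    elim: m => [|m IH]; first by rewrite addn0 /r mulfVK // gt_eqF.
    have [qm0 lcm] := HN (n + m)%N (leq_trans Nn (leq_addr _ _)).
    have [qm1 _] := HN (n + m).+1 (leq_trans Nn (leqW (leq_addr _ _))).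
    rewrite addnS -(ler_pM2r qm0); apply: le_trans lcm _.
    have -> : r * q (n + m).+1 * q (n + m)%N = q (n + m).+1 * (r * q (n + m)%N) by ring.
    by rewrite expr2 ler_pM2l.
  have : c <= r * c.
    have h1 : q m.+1 @[m --> \oo] --> c by rewrite (cvg_shiftS q (nbhs c)).
    have h2 : r * q m @[m --> \oo] --> r * c by apply: cvgMr.
    have h3 : r * q m - q m.+1 @[m --> \oo] --> r * c - c by exact: cvgB.
    rewrite -subr_ge0; apply: (cvgr_to_ge h3); exists n => // m /= nm.
    by rewrite /= subr_ge0 -(subnKC nm).
  by rewrite -{1}[c]mul1r ler_pM2r // leNgt r1.
exists N.+1 => // n /= Nn; have n0 : (0 : R) < n%:R by rewrite ltr0n (leq_trans _ Nn).
rewrite -ler_pdivrMr ?exprn_gt0 //; apply: (cvgr_to_ge Pc).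
exists n => // m /= nm; rewrite -/(q n) -/(q m) -(subnKC nm).
elim: (m - n)%N => [|j IH]; first by rewrite addn0.
rewrite addnS; apply: le_trans IH (incr _ _).
by rewrite (leq_trans (ltnW Nn)) // leq_addr.
Unshelve. all: by end_near. Qed.

End LogConcavity.

(** * Growth of integer counts and common divisors of the parts *)

(** After one step without increase, log-concavity forces a strict decrease forever, impossible for
    nonnegative integers. *)
Lemma strict_logconcave_lt (p : nat -> int) N : (forall n, 0 <= p n) ->
  (forall n, (N <= n)%N -> p n.+2 * p n < p n.+1 ^+ 2) ->
  forall n, (N <= n)%N -> p n < p n.+1.
Proof.
move=> p0 lc n Nn; rewrite ltNge; apply/negP => pn.
have h j : p (n + j).+1 <= p (n + j)%N /\ p (n + j).+1 + j%:R <= p n.+1.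
  elim: j => [|j [IH1 IH2]]; first by rewrite addn0 addr0.
  have := lc (n + j)%N (leq_trans Nn (leq_addr _ _)); rewrite addnS => lcj.
  have p1 := p0 (n + j).+1; have p2 := p0 (n + j).+2.
  have lt : p (n + j).+2 < p (n + j).+1.
    rewrite ltNge; apply/negP => ge; move: lcj; rewrite ltNge expr2 => /negP; apply.
    exact: ler_pM.
  by split; [exact: ltW|lia].
have [_] := h (`|p n.+1|.+1)%N; have := p0 (n + (`|p n.+1|.+1)%N).+1.
have := p0 n.+1; lia.
Qed.

Lemma exprD1_ge (R : realDomainType) (x : R) k : 0 <= x -> x ^+ k.+1 + 1 <= (x + 1) ^+ k.+1.
Proof.
move=> x0; elim: k => [|k IH]; first by rewrite !expr1.
rewrite [X in _ <= X]exprS; apply: le_trans (ler_wpM2l _ IH); last by rewrite addr_ge0.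
have := exprn_ge0 k.+1 x0; rewrite [x ^+ k.+2]exprS; nra.
Qed.

Lemma exprD1_sub_ge (R : realDomainType) (x : R) k : 0 <= x ->
  k.+1%:R * x ^+ k <= (x + 1) ^+ k.+1 - x ^+ k.+1.
Proof.
move=> x0; elim: k => [|k IH]; first by rewrite expr0 !expr1; lra.
have -> : (x + 1) ^+ k.+2 - x ^+ k.+2 =
  x * ((x + 1) ^+ k.+1 - x ^+ k.+1) + (x + 1) ^+ k.+1 by rewrite !(exprS _ k.+1); ring.
have -> : k.+2%:R * x ^+ k.+1 = x * (k.+1%:R * x ^+ k) + x ^+ k.+1.
  by rewrite -[k.+2]addn1 natrD exprS; ring.
apply: lerD; first exact: ler_wpM2l.
by have := exprD1_ge k x0; lra.
Qed.

(** The [+ 1] is the gain per step used in [ser_gt_main_term]; it fails for exponent 1, hence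
    [k.+2]. *)
Lemma exprD1_sub_gt (R : realDomainType) (x : R) k : 0 <= x ->
  k.+2%:R * x ^+ k.+1 + 1 <= (x + 1) ^+ k.+2 - x ^+ k.+2.
Proof.
move=> x0.
have -> : (x + 1) ^+ k.+2 - x ^+ k.+2 =
  x * ((x + 1) ^+ k.+1 - x ^+ k.+1) + (x + 1) ^+ k.+1 by rewrite !(exprS _ k.+1); ring.
have -> : k.+2%:R * x ^+ k.+1 + 1 = x * (k.+1%:R * x ^+ k) + (x ^+ k.+1 + 1).
  by rewrite -[k.+2]addn1 natrD exprS; ring.
by apply: lerD (exprD1_ge k x0); apply/ler_wpM2l/exprD1_sub_ge.
Qed.

(* The lower bound of [csum_ser_ge] exceeds the sum of the main terms
   [n^K / (K! * \prod_(x <- s) x)] by an unbounded amount. *)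
Lemma ser_gt_main_term s K N : all (leq 1) s -> size s = K.+2 ->
  (forall n, (N <= n)%N ->
    (K.+1`! * \prod_(x <- s) x)%:R * ser s n <= n%:R ^+ K.+1) -> False.
Proof.
move=> s0 sK le_main; set D := (K.+1`! * _)%N in le_main.
have lo n : n.+1%:R ^+ K.+2 <= K.+2%:R * D%:R * csum (ser s) n.
  by have := csum_ser_ge n s0; rewrite sK factS -mulnA natrM.
pose C := K.+2%:R * D%:R * csum (ser s) N.
(* The slack grows by 1 per step, so [up] and [lo] together give j <= C for every j. *)
have up j : K.+2%:R * D%:R * csum (ser s) (N + j)%N + j%:R <= C + (N + j).+1%:R ^+ K.+2.
  elim: j => [|j IH].
    by rewrite addn0 addr0 lerDl exprn_ge0.
  rewrite addnS csumS mulrDr.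
  have h1 := exprD1_sub_gt K (ler0n int (N + j).+1).
  have h2 := le_main (N + j).+1 (leqW (leq_addr _ _)).
  have h3 : K.+2%:R * D%:R * ser s (N + j).+1 <= K.+2%:R * (N + j).+1%:R ^+ K.+1.
    by rewrite -mulrA; apply: ler_wpM2l.
  have -> : (N + j).+2%:R = (N + j).+1%:R + 1 :> int by rewrite -natr1.
  rewrite -[j.+1%:R]natr1; lra.
have C0 : 0 <= C.
  by rewrite mulr_ge0 // sumr_ge0 // => i _; exact: ser_ge0.
have := up (`|C|.+1)%N; have := lo (N + `|C|.+1)%N; lia.
Qed.

(** If d divided all parts except possibly x, p(n + x) - p(n) would count partitions into multiples
    of d. Being positive, it would make d divide n + x for all large n. *)
Lemma count_of_increasing s N : (0 < size s)%N -> all (leq 1) s ->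
  (forall n, (N <= n)%N -> ser s n < ser s n.+1) ->
  forall d, (1 < d)%N -> (count (dvdn d) s + 1 < size s)%N.
Proof.
move=> s1 s0 incr d d1; rewrite ltnNge; apply/negP => cnt.
have [t [s' [ss' st ds']]] := perm_split_count s1 cnt.
case: t ss' st => [|x []] //= ss' _.
have /= /andP[x0 s0'] : all (leq 1) (x :: s') by rewrite -(perm_all _ ss').
have lt j n : (N <= n)%N -> ser s n < ser s (n + j.+1)%N.
  move=> Nn; elim: j => [|j IH]; first by rewrite addn1 incr.
  by apply: lt_trans IH _; rewrite (addnS n j.+1) incr // (leq_trans Nn) // leq_addr.
have dvd n : (N <= n)%N -> (d %| n + x)%N.
  move=> Nn; apply/negPn/negP => dn; have := ser_support s0' ds' dn.
  rewrite -(ser_cons _ x0 s0') act_1subXn leq_addl addnK -!(perm_ser _ ss').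
  by have := lt x.-1 n Nn; rewrite prednK // => h /eqP; rewrite subr_eq0 gt_eqF.
have := dvdn_sub (dvd N.+1 (leqnSn N)) (dvd N (leqnn N)).
by rewrite addSn subSnn dvdn1; lia.
Qed.

(** The condition on [B] keeps the second difference below twice its mean size, n^K / K! over the
    product of the parts; concentration on the multiples of d > 1 costs a factor d >= 2. *)
Lemma count_of_second_difference (R : realType) s K N (B : R) :
  size s = K.+3 -> all (leq 1) s -> 0 <= B ->
  B * (K.+1`! * \prod_(x <- s) x)%:R < 2 * K.+1%:R ->
  (forall n, (N <= n)%N ->
     (act ((1 - 'X) ^+ 2) (ser s) n.+1)%:~R <= B * n%:R ^+ K) ->
  forall d, (1 < d)%N -> (count (dvdn d) s + 2 < size s)%N.
Proof.
move=> sK s0 B0 Blt Fle d d1; rewrite ltnNge; apply/negP => cnt.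
have s2 : (2 <= size s)%N by rewrite sK.
have [t [s' [ss' st ds']]] := perm_split_count s2 cnt.
case: t ss' st => [|b [|b' []]] //= ss' _.
have s0b : all (leq 1) [:: b, b' & s'] by rewrite -(perm_all _ ss').
have /= /and3P[b0 b0' s0'] := s0b.
have sK' : size s' = K.+1 by have := perm_size ss'; rewrite sK /= => -[].
pose h := ser s'.
have hle n : (N.+1 + b' + b <= n)%N -> (h n)%:~R <= b%:R * (b'%:R * (B * n%:R ^+ K)).
  move=> Nn; rewrite /h (ser_cons2 _ s0b).
  apply: (act_geom_le (N := N.+1 + b')) Nn => m /andP[Nm mn].
  apply: (act_geom_le (N := N.+1)) Nm => l /andP[Nl lm].
  have -> : act ((1 - 'X) ^+ 2) (ser [:: b, b' & s']) l = act ((1 - 'X) ^+ 2) (ser s) l.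
    by apply: eq_act => i _; rewrite (perm_ser _ ss').
  case: l Nl lm => // l Nl lm; apply: le_trans (Fle _ Nl) _.
  by rewrite ler_wpM2l // lerXn2r ?nnegrE // ler_nat; lia.
pose D := (K.+1`! * \prod_(x <- s') x)%N.
(* On m blocks of length d, [hle] lets [D * csum h] grow like E m^(K+1), while [lo] demands d^(K+1)
   m^(K+1). *)
pose E : R := D%:R * (b%:R * (b'%:R * (B * d%:R ^+ K))) / K.+1%:R.
have d0 : (0 < d)%N by lia.
have lo m : d%:R ^+ K.+1 * m.+1%:R ^+ K.+1 <= D%:R * (csum h (d * m + d.-1))%:~R :> R.
  have := csum_ser_ge (d * m + d.-1) s0'; rewrite sK' -/h -/D -(ler_int R).
  rewrite rmorphXn rmorphM /= !natz -!pmulrn -exprMn -natrM.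
  by rewrite (_ : (d * m + d.-1).+1 = (d * m.+1)%N) //; lia.
(* Within a block only the multiple of d contributes. *)
have csumd m : csum h (d * m.+1 + d.-1) = csum h (d * m + d.-1) + h (d * m.+1)%N.
  have E0 : (d * m.+1)%N = (d * m + d.-1).+1 by lia.
  have z j : (j < d)%N -> csum h (d * m.+1 + j) = csum h (d * m.+1)%N.
    elim: j => [|j IH] jd; first by rewrite addn0.
    rewrite addnS csumS IH ?(ltnW jd) // -addnS [h _](ser_support s0' ds') ?addr0 //.
    by rewrite dvdn_addr ?dvdn_mulr // gtnNdvd.
  by rewrite z ?prednK // {1}E0 csumS -E0.
have E0 : 0 <= E by rewrite !mulr_ge0 ?invr_ge0 ?exprn_ge0.
pose m0 := (N.+1 + b' + b)%N; pose C := D%:R * (csum h (d * m0 + d.-1))%:~R : R.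
have up j : D%:R * (csum h (d * (m0 + j) + d.-1))%:~R <= C + E * (m0 + j).+1%:R ^+ K.+1.
  elim: j => [|j IH]; first by rewrite addn0 lerDl mulr_ge0 ?exprn_ge0.
  rewrite addnS csumd rmorphD /= mulrDr.
  have h1 := exprD1_sub_ge K (ler0n R (m0 + j).+1).
  have h2 : (h (d * (m0 + j).+1)%N)%:~R <=
     b%:R * (b'%:R * (B * (d * (m0 + j).+1)%:R ^+ K)) by apply: hle; nia.
  have h3 : D%:R * (h (d * (m0 + j).+1)%N)%:~R <=
     E * (K.+1%:R * (m0 + j).+1%:R ^+ K).
    apply: le_trans (ler_wpM2l (ler0n _ _) h2) _.
    by rewrite natrM exprMn le_eqVlt; apply/orP; left; apply/eqP; rewrite /E; field;
      rewrite nat1r pnatr_eq0.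
  have h4 := ler_wpM2l E0 h1.
  have -> : (m0 + j).+2%:R = (m0 + j).+1%:R + 1 :> R by rewrite -natr1.
  by lra.
(* The condition on [B] gives E < 2 d^K, and 2 <= d. *)
have Elt : E < d%:R ^+ K.+1.
  have -> : E = B * (K.+1`! * \prod_(x <- s) x)%:R * (d%:R ^+ K / K.+1%:R).
    rewrite (perm_big _ ss') /= !big_cons /E /D !natrM; field.
    by rewrite nat1r pnatr_eq0.
  apply: (@lt_le_trans _ _ (2 * K.+1%:R * (d%:R ^+ K / K.+1%:R))).
    by rewrite ltr_pM2r // divr_gt0 ?exprn_gt0 // ltr0n.
  rewrite exprS (_ : 2 * _ * _ = 2 * d%:R ^+ K).
    by rewrite ler_wpM2r ?exprn_ge0 // ler_nat.
  by field; rewrite nat1r pnatr_eq0.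
have gap0 : 0 < d%:R ^+ K.+1 - E by rewrite subr_gt0.
(* Large enough for the gap between the leading coefficients to outweigh the constant [C]. *)
pose j := Num.bound (C / (d%:R ^+ K.+1 - E)).
have Cj : C < (d%:R ^+ K.+1 - E) * (m0 + j).+1%:R.
  have C0 : 0 <= C.
    by rewrite mulr_ge0 // ler0z sumr_ge0 // => i _; exact: ser_ge0.
  rewrite mulrC -ltr_pdivrMr //.
  apply: lt_le_trans (archi_boundP _) _; first by rewrite divr_ge0 // ltW.
  by rewrite ler_nat -/j; lia.
have pow : (m0 + j).+1%:R <= (m0 + j).+1%:R ^+ K.+1 :> R.
  by apply: ler_eXnr => //; rewrite ler1n.
have := le_trans (lo (m0 + j)%N) (up j).
rewrite -lerBlDr -mulrBl leNgt => /negP; apply.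
by apply: lt_le_trans Cj _; rewrite ler_pM2l.
Qed.

(** * Asymptotics of the count and its first two differences *)

Lemma act_1subX (u : nat -> int) n : act (1 - 'X) u n.+1 = u n.+1 - u n.
Proof. by rewrite -['X]expr1 act_1subXn subn1. Qed.

Lemma act_1subX_sqr (u : nat -> int) n :
  act ((1 - 'X) ^+ 2) u n.+2 = u n.+2 - u n.+1 - (u n.+1 - u n).
Proof. by rewrite expr2 act_mul !act_1subX. Qed.

Section SerAsymptotics.
Variable R : realType.

Lemma cvg_succ_div (x : nat -> R) e (l : R) :
  x n / n%:R ^+ e @[n --> \oo] --> l -> x n.+1 / n%:R ^+ e @[n --> \oo] --> l.
Proof.
move=> xl.
have h1 : 1 + n%:R^-1 @[n --> \oo] --> (1 : R).
  rewrite -[X in _ --> X]addr0; apply: cvgD; [exact: cvg_cst|exact: cvg_invn].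
have he : (1 + n%:R^-1) ^+ e @[n --> \oo] --> (1 : R).
  elim: e {xl} => [|e IH].
    by apply: (@cvg_eq _ (fun=> 1)) => [n|]; [rewrite expr0|exact: cvg_cst].
  apply: (@cvg_eq _ (fun n => (1 + n%:R^-1) * (1 + n%:R^-1) ^+ e)) => [n|].
    by rewrite exprS.
  by rewrite -[X in _ --> X]mulr1; apply: cvgM.
have xl1 : x n.+1 / n.+1%:R ^+ e @[n --> \oo] --> l.
  by rewrite (cvg_shiftS (fun n => x n / n%:R ^+ e) (nbhs l)).
apply: (@cvg_near_eq _ (fun n => x n.+1 / n.+1%:R ^+ e * (1 + n%:R^-1) ^+ e)); last first.
  by rewrite -[X in _ --> X]mulr1; apply: cvgM.
near=> n; have n0 : (n%:R : R) != 0.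
  by rewrite pnatr_eq0 -lt0n; near: n; exists 1%N.
have -> : 1 + n%:R^-1 = n.+1%:R / n%:R :> R by rewrite -natr1; field.
by rewrite exprMn exprVn mulrA mulfVK // expf_neq0 // pnatr_eq0.
Unshelve. all: by end_near. Qed.

Variables (s : seq nat) (K : nat).
Hypothesis s0 : all (leq 1) s.
Let P n : R := (ser s n)%:~R.

(** This and the next two lemmas apply [cvg_act_ser] with zero, one and two differences; each
    difference lowers by one the number of parts allowed to share a divisor. *)
Lemma cvg_ser : size s = K.+1 ->
  (forall d, (1 < d)%N -> (count (dvdn d) s <= K)%N) ->
  P n / n%:R ^+ K @[n --> \oo] --> ((K`! * \prod_(x <- s) x)%:R^-1 : R).
Proof.
move=> sK cnt; have sK' : (K < size s)%N by rewrite sK.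
have := @cvg_act_ser R _ _ sK' s0 cnt; rewrite sK subSS subn0 subnn expr0.
by apply: cvg_eq => n; rewrite act1.
Qed.

Lemma cvg_ser_diff : size s = K.+2 ->
  (forall d, (1 < d)%N -> (count (dvdn d) s <= K)%N) ->
  let c := (K.+1`! * \prod_(x <- s) x)%:R^-1 : R in
  (P n - P n.-1) * n%:R / n%:R ^+ K.+1 @[n --> \oo] --> c * K.+1%:R /\
  (P n.+1 - P n) * n%:R / n%:R ^+ K.+1 @[n --> \oo] --> c * K.+1%:R.
Proof.
move=> sK cnt c; have sK' : (K < size s)%N by rewrite sK.
have := @cvg_act_ser R _ _ sK' s0 cnt.
have -> : (size s - 1 - K = 1)%N by rewrite sK; lia.
have -> : (K`! * \prod_(x <- s) x)%:R^-1 = c * K.+1%:R.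
  by rewrite /c factS -mulnA [in RHS]natrM [in RHS]invfM mulrAC mulVf ?mul1r.
rewrite expr1 => V; have U := cvg_succ_div V.
have div (x : R) n : (0 < n)%N -> x * n%:R / n%:R ^+ K.+1 = x / n%:R ^+ K.
  move=> n0; have n0' : (n%:R : R) != 0 by rewrite pnatr_eq0 -lt0n.
  by rewrite exprS; field; rewrite expf_neq0.
split; [apply: cvg_near_eq V|apply: cvg_near_eq U]; near=> n.
  have n0 : (0 < n)%N by near: n; exists 1%N.
  by rewrite div // -[in X in _ = X](prednK n0) act_1subX (prednK n0) rmorphB.
rewrite div; last by near: n; exists 1%N.
by rewrite act_1subX rmorphB.
Unshelve. all: by end_near. Qed.

Lemma cvg_ser_diff2 : size s = K.+3 ->
  (forall d, (1 < d)%N -> (count (dvdn d) s <= K)%N) ->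
  let c := (K.+2`! * \prod_(x <- s) x)%:R^-1 : R in
  ((P n.+1 - P n) - (P n - P n.-1)) * n%:R ^+ 2 / n%:R ^+ K.+2 @[n --> \oo]
    --> c * (K.+2%:R * (K.+2%:R - 1)).
Proof.
move=> sK cnt c; have sK' : (K < size s)%N by rewrite sK; lia.
have := @cvg_act_ser R _ _ sK' s0 cnt.
have -> : (size s - 1 - K = 2)%N by rewrite sK; lia.
have -> : (K`! * \prod_(x <- s) x)%:R^-1 = c * (K.+2%:R * (K.+2%:R - 1)).
  have p0 : (\prod_(x <- s) x)%:R != 0 :> R by rewrite pnatr_eq0 -lt0n prod_ge1.
  have f0 : K`!%:R != 0 :> R by rewrite pnatr_eq0 -lt0n fact_gt0.
  rewrite /c !factS !natrM -[K.+2]addn1 natrD -[K.+1]addn1 natrD.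
  by field; rewrite p0 f0 !natr1 !pnatr_eq0.
move=> /cvg_succ_div; apply: cvg_near_eq; near=> n.
have n0 : (0 < n)%N by near: n; exists 1%N.
have n0' : (n%:R : R) != 0 by rewrite pnatr_eq0 -lt0n.
have -> : act ((1 - 'X) ^+ 2) (ser s) n.+1 =
    ser s n.+1 - ser s n - (ser s n - ser s n.-1).
  by rewrite -{1}(prednK n0) act_1subX_sqr (prednK n0).
rewrite !rmorphB /= -/(P n) -/(P n.+1) -/(P n.-1) !exprS.
by field; rewrite expf_neq0.
Unshelve. all: by end_near. Qed.

End SerAsymptotics.

(** * The criterion for a list of parts *)

Section LogConcaveSer.
Variables (R : realType) (s : seq nat) (alpha : R).
Hypothesis s0 : all (leq 1) s.
Hypothesis alpha0 : 0 < alpha.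
Let P n : R := (ser s n)%:~R.
Let LC := \forall n \near \oo, P n.+1 * P n.-1 < P n ^+ 2 * (1 - n%:R ^- 2) `^ alpha.

Let main_coef_gt0 K : 0 < (K`! * \prod_(x <- s) x)%:R^-1 :> R.
Proof. by rewrite invr_gt0 ltr0n muln_gt0 fact_gt0 prod_ge1. Qed.

Let PU : \forall n \near \oo, P n.+1 = P n + (P n.+1 - P n).
Proof. by apply: nearW => n; rewrite addrC subrK. Qed.

Let PV : \forall n \near \oo, P n.-1 = P n - (P n - P n.-1).
Proof. by apply: nearW => n; rewrite opprB addrC subrK. Qed.

Lemma logconcave_ser_of_count : alpha + 1 < (size s)%:R ->
  (forall d, (1 < d)%N -> (count (dvdn d) s + 2 < size s)%N) -> LC.
Proof.
(* The case d = 2 alone forces at least three parts. *)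
move=> aK cnt; have [K sK] : exists K, size s = K.+3.
  by case: (size s) (cnt 2%N isT) => [|[|[|K]]] //; [lia..|exists K].
have cnt1 d : (1 < d)%N -> (count (dvdn d) s <= K)%N by move/cnt; rewrite sK; lia.
have cnt2 d : (1 < d)%N -> (count (dvdn d) s <= K.+1)%N by move/cnt1/leqW.
have cnt3 d : (1 < d)%N -> (count (dvdn d) s <= K.+2)%N by move/cnt2/leqW.
have Pc := @cvg_ser R _ _ s0 sK cnt3; have [Vc Uc] := @cvg_ser_diff R _ _ s0 sK cnt2.
have Fc := @cvg_ser_diff2 R _ _ s0 sK cnt1.
apply: (logconcave_of_cvg (main_coef_gt0 _) Pc Uc Vc PU PV _ Fc); first exact: nearW.
by rewrite ltW //= -(ltrD2r 1) natr1 -sK.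
Qed.

Lemma size2_prod1 : size s = 2%N -> (\prod_(x <- s) x = 1)%N -> s = [:: 1; 1]%N.
Proof.
case: s => [|x [|y []]] // _; rewrite !big_cons big_nil muln1 => /eqP.
by rewrite muln_eq1 => /andP[/eqP -> /eqP ->].
Qed.

(** Two parts are too few for [cvg_ser_diff2], but here (1 - X)^2 is [den s] itself, so the second
    difference is eventually 0, in accordance with K (K - 1) = 0 for K = 1. *)
Lemma logconcave_ser_pair : alpha + 1 < 2 -> size s = 2%N ->
  (\prod_(x <- s) x = 1)%N -> LC.
Proof.
move=> a1 sK s1; have sE := size2_prod1 sK s1.
have cnt d : (1 < d)%N -> (count (dvdn d) s <= 0)%N.
  by move=> d1; rewrite sE /= dvdn1; case: eqP d1 => // ->.
have cnt1 d : (1 < d)%N -> (count (dvdn d) s <= 1)%N by move/cnt/leqW.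
have Pc := @cvg_ser R _ _ s0 sK cnt1; have [Vc Uc] := @cvg_ser_diff R _ _ s0 sK cnt.
pose F n := P n.+1 - P n - (P n - P n.-1).
have F0 : \forall n \near \oo, F n = 0.
  exists 1%N => // -[|n] //= _; rewrite /F /P -!rmorphB /= -act_1subX_sqr.
  have -> : (1 - 'X) ^+ 2 = den s.
    by rewrite sE den_cons den_cons /den big_nil mulr1 expr1 expr2.
  by rewrite act_den_ser.
have Fc : F n * n%:R ^+ 2 / n%:R ^+ 1 @[n --> \oo] -->
    ((1`! * \prod_(x <- s) x)%:R^-1 * (1%:R * (1%:R - 1)) : R).
  rewrite subrr !mulr0; apply: (@cvg_near_eq _ (fun=> 0)); last exact: cvg_cst.
  by apply: filterS F0 => n ->; rewrite !mul0r.
apply: (logconcave_of_cvg (main_coef_gt0 _) Pc Uc Vc PU PV _ Fc); first exact: nearW.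
by rewrite ltW //= -(ltrD2r 1).
Qed.

Lemma near_ser_logconcave : LC ->
  exists2 N, (1 <= N)%N & forall n, (N <= n)%N -> ser s n.+2 * ser s n < ser s n.+1 ^+ 2.
Proof.
case=> N _ HN; exists N.+1 => // n Nn.
have n2 : (2 <= n.+1)%N by rewrite ltnS (leq_trans _ Nn).
have /andP[t0 t1] := inv_sqr_itv R n2.
rewrite -(ltr_int R) rmorphM rmorphXn /=.
apply: lt_le_trans (HN n.+1 (leq_trans (ltnW Nn) (leqnSn _))) _.
rewrite -[X in _ <= X]mulr1 ler_wpM2l ?sqr_ge0 //.
have one : 1 `^ alpha = 1 by rewrite powR1.
rewrite -[X in _ <= X]one; apply: ge0_ler_powR; rewrite ?nnegrE ?(ltW alpha0) //.
by rewrite subr_ge0 ltW.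
Qed.

Lemma count_of_logconcave_ser : (0 < size s)%N -> LC ->
  [/\ exists N, forall n, (N <= n)%N -> ser s n < ser s n.+1,
      (2 <= size s)%N &
      forall d, (1 < d)%N -> (count (dvdn d) s + 1 < size s)%N].
Proof.
move=> s1 /near_ser_logconcave[N N1 lc].
have incr := strict_logconcave_lt (ser_ge0 s) lc.
have cnt := count_of_increasing s1 s0 incr.
by split; [exists N| have := cnt 2%N isT; lia|].
Qed.

Lemma exponent_lt_of_logconcave_ser : (0 < size s)%N -> LC -> alpha + 1 < (size s)%:R.
Proof.
move=> s1 lc; have [[N incr] s2 cnt] := count_of_logconcave_ser s1 lc.
have [K sK] : exists K, size s = K.+2 by case: (size s) s2 => [|[|K]] //; exists K.
rewrite sK -natr1 ltrD2r ltNge; apply/negP => aK.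
have cnt1 d : (1 < d)%N -> (count (dvdn d) s <= K.+1)%N by move/cnt; rewrite sK; lia.
have Pc := @cvg_ser R _ _ s0 sK cnt1.
have P0 : \forall n \near \oo, 0 < P n.
  exists N.+1 => // -[|n] //= Nn; rewrite /P ltr0z.
  by apply: le_lt_trans (ser_ge0 s n) (incr n _).
(* Since 0 < 1 - n^-2 <= 1 and alpha >= K + 1, the real power is at most the integer power K + 1, so
   the count would eventually stay below its main term. *)
have : \forall n \near \oo, P n <= (K.+1`! * \prod_(x <- s) x)%:R^-1 * n%:R ^+ K.+1.
  apply: (le_limit_of_logconcave (main_coef_gt0 _) Pc P0).
  near=> n.
  have n2 : (2 <= n)%N by near: n; exists 2%N.
  have /andP[t0 t1] := inv_sqr_itv R n2.
  apply: lt_le_trans (_ : P n ^+ 2 * (1 - n%:R ^- 2) `^ alpha <= _); first by near: n.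
  rewrite ler_wpM2l ?sqr_ge0 // -[X in _ <= X]powR_mulrn; last by rewrite subr_ge0 ltW.
  by apply: ger_powR => //; rewrite subr_gt0 t1 gerBl.
case=> N' _ HN'; apply: (@ser_gt_main_term s K N' s0 sK) => n Nn.
have := main_coef_gt0 K.+1; rewrite invr_gt0.
move: (K.+1`! * _)%N (HN' n Nn) => D; rewrite mulrC => h D0; move: h.
by rewrite ler_pdivlMr // -(ler_int R) rmorphM rmorphXn /= !natz -!pmulrn mulrC.
Unshelve. all: by end_near. Qed.

Lemma logconcave_serP : (0 < size s)%N -> LC <->
  alpha + 1 < (size s)%:R /\
  (size s = 2%N /\ (\prod_(x <- s) x = 1)%N \/
   forall d, (1 < d)%N -> (count (dvdn d) s + 2 < size s)%N).
Proof.
move=> s1; split=> [lc|[aK [[sK s1']|cnt]]]; first last.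
- exact: logconcave_ser_of_count.
- by apply: logconcave_ser_pair; rewrite // -sK.
have aK := exponent_lt_of_logconcave_ser s1 lc; split=> //.
have [[N incr] s2 cnt] := count_of_logconcave_ser s1 lc.
have [K sK] : exists K, size s = K.+2 by case: (size s) s2 => [|[|K]] //; exists K.
have cnt1 d : (1 < d)%N -> (count (dvdn d) s <= K)%N by move/cnt; rewrite sK; lia.
have cnt2 d : (1 < d)%N -> (count (dvdn d) s <= K.+1)%N by move/cnt1/leqW.
have Pc := @cvg_ser R _ _ s0 sK cnt2; have [Vc Uc] := @cvg_ser_diff R _ _ s0 sK cnt1.
case: K sK {cnt1 cnt2} Pc Vc Uc => [|K] sK Pc Vc Uc.
  (* Two parts: the differences are integers at least 1 tending to the inverse of the product, which
     is thus at most 1. *)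
  left; split=> //; have p0 := prod_ge1 s0.
  suff : 1 <= (1`! * \prod_(x <- s) x)%:R^-1 * 1%:R :> R.
    by rewrite mulr1 mul1n invf_ge1 ?ltr0n // lern1; lia.
  apply: (cvgr_to_ge Uc); exists N.+1 => // n /= Nn.
  rewrite expr1 mulfK ?pnatr_eq0; last by lia.
  rewrite /P -rmorphB /= -(rmorph1 (intr : int -> R)) ler_int.
  by have := incr n (ltnW Nn); lia.
right; pose B : R := (K.+2`! * \prod_(x <- s) x)%:R^-1 * (K.+2%:R ^+ 2 - alpha / 2).
have K2 : (2 : R) <= K.+2%:R by rewrite ler_nat.
have aK2 : alpha < K.+2%:R by move: aK; rewrite sK -natr1 ltrD2r.
have B0 : 0 <= B.
  rewrite mulr_ge0 ?(ltW (main_coef_gt0 _)) // subr_ge0 expr2; nra.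
have FB : \forall n \near \oo,
    (P n.+1 - P n - (P n - P n.-1)) * n%:R ^+ 2 <= B * n%:R ^+ K.+2.
  apply: (second_difference_le (main_coef_gt0 _) Pc Uc Vc alpha0 PU PV _ lc).
  exact: nearW.
case: FB => N' _ HN'.
apply: (@count_of_second_difference R s K N'.+1 B sK s0 B0) => [|n Nn].
  have c0 := main_coef_gt0 K.+2.
  have -> : B * (K.+1`! * \prod_(x <- s) x)%:R = (K.+2%:R ^+ 2 - alpha / 2) / K.+2%:R.
    have E (f p : nat) (y : R) : (0 < f)%N -> (0 < p)%N ->
        (K.+2 * f * p)%:R^-1 * y * (f * p)%:R = y / K.+2%:R.
      move=> f0 p0; rewrite !natrM; field.
      by rewrite -natrD !pnatr_eq0 -!lt0n f0 p0.
    by rewrite /B factS E ?fact_gt0 ?prod_ge1.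
  rewrite ltr_pdivrMr ?ltr0n // -[K.+2%:R]natr1.
  have : 1 <= K.+1%:R :> R by rewrite ler1n.
  (* With x = K + 1 the gap is x^2 - 1 + alpha / 2; for K = 0 its positivity rests on alpha > 0
     alone. *)
  move: (K.+1%:R : R) => x x1; have xx : 1 <= x * x by nra.
  rewrite -subr_gt0 (_ : _ - _ = x * x - 1 + alpha / 2); last by field.
  by rewrite ltr_wpDl ?divr_gt0 // subr_ge0.
have n0 : (0 : R) < n%:R by rewrite ltr0n (leq_trans _ Nn).
have := HN' n (ltnW Nn).
have -> : B * n%:R ^+ K.+2 = B * n%:R ^+ K * n%:R ^+ 2 by rewrite !exprS; ring.
rewrite ler_pM2r ?exprn_gt0 //; congr (_ <= _).
by case: n Nn n0 => // n _ _; rewrite act_1subX_sqr !rmorphB.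
Qed.

End LogConcaveSer.

(** * From lists of parts back to indexed sequences *)

Theorem theorem3p5 (R : realType) (a : nat -> nat) (k : nat) (alpha : R)
  (a_pos : forall i, (0 < a i)%N)
  (a_incr : forall i j, (i <= j)%N -> (a i <= a j)%N)
  (k_pos : (0 < k)%N) (alpha_pos : 0 < alpha) :
  (exists N : nat, forall n : nat, (N <= n)%N -> (2 <= n)%N ->
     ((pA a n k)%:R / (n%:R `^ alpha)) ^+ 2 >
     ((pA a n.+1 k)%:R / (n.+1%:R `^ alpha)) *
     ((pA a n.-1 k)%:R / (n.-1%:R `^ alpha)))
  <->
  (alpha + 1 < k%:R /\
   (((2 <= k <= 3)%N /\ (forall i, (i < k)%N -> a i = 1%N)) \/
    ((4 <= k)%N /\
     forall S : {set 'I_k}, #|S| = (k - 2)%N -> gcd_sub a S = 1%N))).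
Proof.
pose s := [seq a (nat_of_ord i) | i : 'I_k].
have sk : size s = k by rewrite size_image card_ord.
have s0 : all (leq 1) s by apply/allP => x /mapP[i _ ->].
have pE n : (pA a n k)%:R = (ser s n)%:~R :> R by rewrite -pA_ser natz -pmulrn.
have all1P : (forall i, (i < k)%N -> a i = 1%N) <-> all (pred1 1%N) s.
  split=> [a1|/allP s1 i ik]; first by apply/allP => x /mapP[i _ ->]; rewrite /= a1.
  by apply/eqP/s1/mapP; exists (Ordinal ik); rewrite ?mem_enum.
have LCE : (exists N : nat, forall n : nat, (N <= n)%N -> (2 <= n)%N ->
     ((pA a n k)%:R / (n%:R `^ alpha)) ^+ 2 >
     ((pA a n.+1 k)%:R / (n.+1%:R `^ alpha)) *
     ((pA a n.-1 k)%:R / (n.-1%:R `^ alpha))) <->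
   \forall n \near \oo, ((ser s n.+1)%:~R * (ser s n.-1)%:~R : R)
      < (ser s n)%:~R ^+ 2 * (1 - n%:R ^- 2) `^ alpha.
  split=> [[N lc]|[N _ lc]].
    exists (maxn N 2) => // n /=; rewrite geq_max => /andP[Nn n2].
    by have := lc n Nn n2; rewrite powR_logconcaveE // !pE.
  exists N => n Nn n2; rewrite powR_logconcaveE // !pE; exact: lc.
have s1 : (0 < size s)%N by rewrite sk.
apply: (iff_trans LCE); apply: (iff_trans (logconcave_serP s0 alpha_pos s1)); rewrite sk.
split=> -[ak h]; split=> //.
  case: h => [[k2 p1]|cnt].
    left; rewrite k2; split=> //; rewrite -k2; apply/all1P.
    by rewrite (size2_prod1 _ p1) // sk.
  have k3 : (3 <= k)%N by have := cnt 2%N isT; lia.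
  case: (ltnP 3 k) => k4; [right|left].
    split=> //; apply/gcd_sub_count => //; first by rewrite subn_gt0; lia.
    by move=> d /cnt; rewrite -/s; lia.
  have k3E : k = 3%N by lia.
  split; first by rewrite k3E.
  (* For k = 3 no d > 1 divides any part; a part x > 1 violates this with d = x. *)
  apply/all1P/allP => x xs /=; have x0 : (0 < x)%N := allP s0 _ xs.
  rewrite eqn_leq x0 andbT leqNgt; apply/negP => /cnt.
  rewrite k3E => cntx; have c0 : count (dvdn x) s = 0%N by lia.
  have : has (dvdn x) s by apply/hasP; exists x.
  by rewrite has_count c0.
case: h => [[/andP[k2 k3] /all1P s1']|[k4 gcd1]].
  have sE : s = nseq k 1%N by rewrite -sk; apply/all_pred1P.
  have [k2E|k3E] : k = 2%N \/ k = 3%N by lia.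
    left; split=> //; rewrite sE k2E /= !big_cons big_nil //.
  right=> d d1; rewrite sE count_nseq dvdn1; case: eqP d1 => [->//|_ _].
  by rewrite k3E.
right=> d d1; have k20 : (0 < k - 2)%N by rewrite subn_gt0; lia.
have := (gcd_sub_count k a_pos k20).1 gcd1 d d1; rewrite -/s; lia.
Qed.
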